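(* Let $k\in\mathbb{N}$ and $d\in\mathbb{R}$ with $k\ge 2$ and $d\ge 2$. There exist a real number $\tau_0=\tau_0(k,d)>0$ and a positive integer $L_0=L_0(k,d)$ such that the following holds. Let $\tau<\tau_0$, let $G$ be a strongly $\binom{k}{2}$-free $\tau$-critical graph, and let $\mathcal{A}=(A_i:1\le i\le t)$ be an equicardinal blockade in $G$, with union $A=A_1\cup\dots\cup A_t$, such that - the width of $\mathcal{A}$ is $\frac{|G|}{t^d}$, and $\frac{|G|}{t^{2d}}\le W_G$; - the length $t$ of $\mathcal{A}$ satisfies $L_0\le t\le 2|G|^{1/d}$; - $|E(a,A)|<\frac{|G|}{t^d}$ for all $a\in A$. Then there exist $b\in A$ and a $\left(t',\frac{|G|}{t^{2d+2}}\right)$-comb $((a_j,A_j'):1\le j\le t')$ in $(E_b\cap A,\ \neg E_b\cap A)$ such that $\mathcal{A}'=(A_j':1\le j\le t')$ is an equicardinal minor of $\mathcal{A}$ of width at least $\frac{|G|}{t^{2d+2}}$ and length $t'\ge t^{1/8}$.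
   Context: A graph $G=(V,E)$ has a finite vertex set $V=V(G)$ and a symmetric anti-reflexive edge relation $E$; $|G|=|V(G)|$, and $\overline{G}$ is the complement graph. For a vertex $a$ and $X\subseteq V(G)$: $E(a,X)=\{x\in X: E(a,x)\}$, $E_a=\{x\in V(G):E(a,x)\}$, $\neg E_a=\{x\in V(G):\neg E(a,x)\}$. Cographs: the class of cographs is the smallest class of graphs containing all one-vertex graphs and closed under complement and disjoint union. A cograph in $G$ is an induced subgraph of $G$ that is a cograph; its size is its number of vertices. $G$ is $\tau$-critical if the largest size of a cograph in $G$ is $<|G|^\tau$, and every induced subgraph $G'\ne G$ of $G$ contains a cograph of size $\ge |G'|^\tau$. $\binom{k}{2}$-property: vertices $a_1,\dots,a_k$ have $\binom{k}{2}$-property over $X\subseteq V(G)$ if there exist $\{b_{ij}\}_{1\le i<j\le k}\subseteq X$ such that for all $1\le i<j\le k$, $b_{ij}$ is adjacent to $a_i$ and to $a_j$, and is not adjacent to $a_m$ for every $m\ne i,j$. $G$ is $\binom{k}{2}$-free if no $k$-tuple of distinct vertices of $G$ has $\binom{k}{2}$-property over $V(G)$. $G$ is strongly $\binom{k}{2}$-free if both $G$ and $\overline{G}$ are $\binom{k}{2}$-free. Blockades: a blockade in $G$ is a sequence $\mathcal{B}=(B_1,\dots,B_t)$ of pairwise disjoint (nonempty) subsets of $V(G)$, called blocks; its length is $t$ and its width is the minimum cardinality of a block. It is equicardinal if all blocks have the same cardinality. A sub-blockade of $(B_i:i\in I)$ is $(B_i:i\in I')$ with $I'\subseteq I$; a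 contraction is $(B_i':i\in I)$ with $\emptyset\neq B_i'\subseteq B_i$; a minor is a contraction of a sub-blockade. Blocks of a minor may be re-indexed, so $(B'_j:1\le j\le t')$ is a minor of $(B_i: 1\le i\le t)$ when there is an injection $j\mapsto i_j$ with $\emptyset\ne B'_j\subseteq B_{i_j}$. Combs: for an integer $t\geq 0$ and real $w\ge 0$, $((a_i,B_i):1\le i\le t)$ is a $(t,w)$-comb in $G$ if $a_1,\dots,a_t\in V(G)$ are distinct; $B_1,\dots,B_t$ are pairwise disjoint subsets of $V(G)\setminus\{a_1,\dots,a_t\}$; each $a_i$ is adjacent to every vertex of $B_i$; for $i\ne j$, $a_i$ has no neighbour in $B_j$; and $|B_i|\ge w$ for all $i$. If $C,D\subseteq V(G)$ are disjoint, $a_1,\dots,a_t\in C$ and $B_1,\dots,B_t\subseteq D$, it is called a $(t,w)$-comb in $(C,D)$. The quantity $W_G$: let $\mathcal{F}_G$ be the set of all sequences $((b_i,B_i):1\le i\le s)$ in $G$, over all $s\ge 1$, such that for some vertex $a\in V(G)$ the sequence is an $\left(s,\frac{|G|}{s^2}\right)$-comb in $(E_a,\neg E_a)$ and $(B_i:1\le i\le s)$ is an equicardinal blockade. $\mathcal{F}_{\overline{G}}$ is the same set defined for the graph $\overline{G}$ (all adjacencies taken in $\overline{G}$). If $\mathcal{F}_G\cup\mathcal{F}_{\overline{G}}\ne\emptyset$, $W_G$ is the minimum width of a blockade $(B_i:1\le i\le s)$ over all $((b_i,B_i):1\le i\le s)\in\mathcal{F}_G\cup\mathcal{F}_{\overline{G}}$;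 otherwise $W_G=|G|$. *)

(* Defs.v *)
From mathcomp Require Import all_boot all_order all_algebra.
From mathcomp Require Import boolp reals exp.

Set Implicit Arguments.
Unset Strict Implicit.
Unset Printing Implicit Defensive.

Import Order.TTheory GRing.Theory Num.Theory.

Local Open Scope ring_scope.

Record sgraph := SGraph {
  vertex :> finType;
  adj : rel vertex;
  adj_sym : symmetric adj;
  adj_irrefl : irreflexive adj }.

Section Operations.
Variables G H : sgraph.

Definition compl_adj : rel G := fun x y => (x != y) && ~~ adj x y.

Lemma compl_adj_sym : symmetric compl_adj.
Proof. by move=> x y; rewrite /compl_adj eq_sym adj_sym. Qed.

Lemma compl_adj_irrefl : irreflexive compl_adj.
Proof. by move=> x; rewrite /compl_adj eqxx. Qed.

Definition compl : sgraph := SGraph compl_adj_sym compl_adj_irrefl.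

Definition union_adj : rel (G + H)%type := fun u v =>
  match u, v with
  | inl x, inl y => adj x y
  | inr x, inr y => adj x y
  | _, _ => false
  end.

Lemma union_adj_sym : symmetric union_adj.
Proof. by move=> [x|x] [y|y] //=; rewrite adj_sym. Qed.

Lemma union_adj_irrefl : irreflexive union_adj.
Proof. by move=> [x|x] /=; rewrite adj_irrefl. Qed.

Definition disjoint_union : sgraph := SGraph union_adj_sym union_adj_irrefl.

Variable X : {set G}.

Definition induced_adj : rel {x : G | x \in X} := fun x y => adj (val x) (val y).

Lemma induced_adj_sym : symmetric induced_adj.
Proof. by move=> x y; rewrite /induced_adj adj_sym. Qed.

Lemma induced_adj_irrefl : irreflexive induced_adj.
Proof. by move=> x; rewrite /induced_adj adj_irrefl. Qed.

Definition induced : sgraph := SGraph induced_adj_sym induced_adj_irrefl.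

Definition isomorphic : Prop :=
  exists2 f : G -> H, bijective f & forall x y, adj (f x) (f y) = adj x y.

End Operations.

(* Classes of graphs are closed under isomorphism, hence the last clause.
   The graph without vertices is not a cograph. *)
Inductive cograph : sgraph -> Prop :=
| cograph_vertex (G : sgraph) : #|G| = 1%N -> cograph G
| cograph_compl (G : sgraph) : cograph G -> cograph (compl G)
| cograph_union (G H : sgraph) :
    cograph G -> cograph H -> cograph (disjoint_union G H)
| cograph_iso (G H : sgraph) : isomorphic G H -> cograph G -> cograph H.

Definition max_cograph (G : sgraph) : nat :=
  \max_(X : {set G} | `[< cograph (induced X) >]) #|X|.

(* The proper induced subgraphs G' of G are the G[X] with X != setT; the
   convention is that graphs are nonempty (no set of vertices of the empty graph
   induces a cograph, so admitting X = set0 would make the notion void). An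
   induced subgraph of G[X] is a G[Y] with Y \subset X. *)
Definition tau_critical (R : realType) (tau : R) (G : sgraph) : Prop :=
  (max_cograph G)%:R < #|G|%:R `^ tau /\
  forall X : {set G}, X != set0 -> X != setT ->
    exists Y : {set G},
      [/\ Y \subset X, cograph (induced Y) & #|X|%:R `^ tau <= #|Y|%:R].

Section Notions.
Variable G : sgraph.
Implicit Types (C D X : {set G}).

Definition nbr_in (a : G) X : {set G} := [set x in X | adj a x].
Definition nbr (a : G) : {set G} := [set x | adj a x].
Definition non_nbr (a : G) : {set G} := [set x | ~~ adj a x].

(* Only the values b i j with i < j are relevant. *)
Definition binom2_property (k : nat) (a : 'I_k -> G) X : Prop :=
  exists b : 'I_k -> 'I_k -> G, forall i j : 'I_k, (i < j)%N ->
    [/\ b i j \in X, adj (b i j) (a i), adj (b i j) (a j) &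
        forall m : 'I_k, m != i -> m != j -> ~~ adj (b i j) (a m)].

Definition binom2_free (k : nat) : Prop :=
  ~ exists2 a : 'I_k -> G, injective a & binom2_property a setT.

Definition pairwise_disjoint (t : nat) (B : 'I_t -> {set G}) : Prop :=
  forall i j, i != j -> [disjoint B i & B j].

Definition blockade (t : nat) (B : 'I_t -> {set G}) : Prop :=
  pairwise_disjoint B /\ forall i, B i != set0.

(* The minimum of the #|B i| as soon as 0 < t, since #|B i| <= #|G|. *)
Definition width (t : nat) (B : 'I_t -> {set G}) : nat :=
  \big[minn/#|G|]_(i < t) #|B i|.

Definition equicardinal_blockade (t : nat) (B : 'I_t -> {set G}) : Prop :=
  blockade B /\ forall i j, #|B i| = #|B j|.

Definition minor (t' t : nat) (B' : 'I_t' -> {set G}) (B : 'I_t -> {set G}) :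
    Prop :=
  exists2 f : 'I_t' -> 'I_t, injective f &
    forall j, B' j != set0 /\ B' j \subset B (f j).

Definition comb (R : realType) (t : nat) (w : R) (a : 'I_t -> G)
    (B : 'I_t -> {set G}) : Prop :=
  [/\ injective a,
      pairwise_disjoint B /\ (forall i j, a i \notin B j),
      forall i x, x \in B i -> adj (a i) x,
      forall i j x, i != j -> x \in B j -> ~~ adj (a i) x &
      forall i, w <= #|B i|%:R].

Definition comb_in (R : realType) C D (t : nat) (w : R) (a : 'I_t -> G)
    (B : 'I_t -> {set G}) : Prop :=
  [/\ [disjoint C & D], comb w a B, forall i, a i \in C &
      forall i, B i \subset D].

(* Membership of ((b i, B i))_(i < s) in F_G. *)
Definition in_F (R : realType) (s : nat) (b : 'I_s -> G) (B : 'I_s -> {set G}) :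
    Prop :=
  [/\ (0 < s)%N,
      exists a : G,
        comb_in (nbr a) (non_nbr a) (#|G|%:R / s%:R ^+ 2 : R) b B &
      equicardinal_blockade B].

End Notions.

Definition strongly_binom2_free (k : nat) (G : sgraph) : Prop :=
  binom2_free G k /\ binom2_free (compl G) k.

Definition F_width (R : realType) (G : sgraph) : pred nat := fun m =>
  `[< exists (s : nat) (b : 'I_s -> G) (B : 'I_s -> {set G}),
        (in_F R b B \/ @in_F (compl G) R s b B) /\ width B = m >].

Definition W (R : realType) (G : sgraph) : nat :=
  if pselect (exists m, F_width R G m) is left nonempty then ex_minn nonempty
  else #|G|.

(* Main.v *)
(* A vertex b is sought whose second neighbourhood in A is large. If there is
   none, repeatedly take a vertex b of maximum degree in what is left of A, and
   remove the closed neighbourhood of N[b]. The sets N[b] are pairwise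
   anticomplete, each one has a cograph of size at least |N[b]|^tau by
   criticality, and only few vertices are removed with each N[b]; so the union of
   these cographs is too large. That few vertices are removed is the assumption
   on second neighbourhoods as long as the maximum degree is at least n / t^(2d);
   afterwards it follows from the bound on W_G, because a set covered by
   vertices of degree at most D either has size O(sqrt(n D)) or admits an
   (s, n / s^2)-comb of width at most D.

   Given b, the same bound shows that most of the second neighbourhood of b can
   be partitioned into pieces, each of size at least 2n / t^(2d+2), inside one
   block and inside the neighbourhood of one neighbour of b. As degrees and
   blocks are small, about t^(1/8) pieces in different blocks can be chosen that
   are mostly missed by the neighbourhoods belonging to the other ones. *)
Require Import Defs.
From mathcomp Require Import all_boot all_order all_algebra.
From mathcomp Require Import boolp reals exp.
From mathcomp Require Import ring lra.

Set Implicit Arguments.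
Unset Strict Implicit.
Unset Printing Implicit Defensive.

Import Order.TTheory GRing.Theory Num.Theory.

Local Open Scope ring_scope.

(** * Combs extracted from covers by vertices of small degree *)

Section Combs.
Variables (R : realType) (G : sgraph).
Implicit Types (S T C B X : {set G}) (a c x : G) (Gam Del : R).

Lemma natr_sum_mem (X : {set G}) (P : pred G) :
  (#|[set x in X | P x]|)%:R = \sum_(x in X) (P x)%:R :> R.
Proof.
rewrite -sum1_card natr_sum (eq_bigl (fun x => (x \in X) && P x)); last first.
  by move=> x; rewrite inE.
by rewrite big_mkcondr /=; apply: eq_bigr => x _; case: (P x).
Qed.

Definition codeg S x : nat := #|[set c in S | adj c x]|.

Lemma sum_codeg S X :
  \sum_(c in S) (#|nbr_in c X|)%:R = \sum_(x in X) (codeg S x)%:R :> R.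
Proof.
under eq_bigr do rewrite natr_sum_mem.
by rewrite exchange_big /=; apply: eq_bigr => x _; rewrite natr_sum_mem.
Qed.

Lemma codegD1 S c x : c \in S -> codeg S x = (adj c x + codeg (S :\ c) x)%N.
Proof.
move=> cS; rewrite /codeg (cardsD1 c) inE cS /=; congr (_ + _)%N.
by apply: eq_card => y; rewrite !inE andbA.
Qed.

Lemma codegU1 S c x : c \notin S -> codeg (c |: S) x = (adj c x + codeg S x)%N.
Proof.
move=> cS; rewrite (@codegD1 _ c) ?setU11 //; congr (_ + codeg _ _)%N.
by rewrite setU1K.
Qed.

Lemma codeg1_uniq S c c' x :
  c \in S -> c' \in S -> codeg S x = 1%N -> adj c x -> adj c' x -> c' = c.
Proof.
move=> cS c'S /eqP/cards1P[e E] cx c'x.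
have: c \in [set e] by rewrite -E inE cS.
have: c' \in [set e] by rewrite -E inE c'S.
by rewrite !inE => /eqP-> /eqP->.
Qed.

Lemma ex_max_set (P : pred {set G}) (F : {set G} -> R) (S0 : {set G}) : P S0 ->
  exists2 S, P S & forall S', P S' -> F S' <= F S.
Proof. by move=> P0; case: (arg_maxP F P0) => S PS H; exists S. Qed.

(* [S] maximizes the number of vertices of [D] covered exactly once, minus
   [l * #|S|]. Deleting a vertex of [S] shows that its private neighbourhood has
   size at least [l]; adding one bounds what [S] leaves uncovered. *)
Lemma private_neighbours T D (l m Del : R) :
  (forall c, c \in T -> (#|nbr_in c D|)%:R <= Del) ->
  (forall x, x \in D -> (0 < codeg T x)%N /\ (codeg T x)%:R <= m) ->
  0 <= l -> 0 <= m ->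
  exists2 S : {set G}, S \subset T &
    (forall c, c \in S -> l <= (#|[set x in D | adj c x & codeg S x == 1%N]|)%:R) /\
    (#|D|)%:R <= l * (#|T|)%:R + (m + 1) * Del * (#|S|)%:R.
Proof.
move=> degD codD l0 m0.
pose U k S := [set x in D | codeg S x == k].
have [S ST Smax] := @ex_max_set (fun S => S \subset T)
   (fun S => (#|U 1%N S|)%:R - l * (#|S|)%:R) set0 (sub0set T).
exists S => //; split.
  move=> c cS; have := Smax (S :\ c); rewrite (subset_trans (subD1set S c)) //.
  move=> /(_ isT); rewrite (cardsD1 c S) cS natrD mulrDr mulr1.
  have : (#|U 1%N S| <= #|[set x in D | adj c x & codeg S x == 1%N]|
          + #|U 1%N (S :\ c)|)%N.
    apply: leq_trans (leq_card_setU _ _); apply: subset_leq_card.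
    apply/subsetP => x; rewrite !inE (codegD1 x cS) => /andP[-> E] /=; move: E.
    by case: (adj c x) => /= ->.
  by rewrite -(ler_nat R) natrD; lra.
have U0c c : c \in T ->
    (#|nbr_in c (U 0%N S)|)%:R <= l + (#|nbr_in c (U 1%N S)|)%:R
.
  move=> cT; case: (boolP (c \in S)) => cS.
    rewrite (_ : nbr_in c (U 0%N S) = set0) ?cards0 ?addr_ge0 //.
    apply/setP => x; rewrite !inE.
    by rewrite (codegD1 x cS); case: (adj c x); rewrite ?andbF.
  have := Smax (c |: S); rewrite subUset sub1set cT ST => /(_ isT).
  rewrite cardsU1 cS natrD mulrDr mulr1.
  have : (#|U 1%N S| + #|nbr_in c (U 0%N S)|
     <= #|nbr_in c (U 1%N S)| + #|U 1%N (c |: S)|)%N.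
    rewrite -cardsUI.
    have -> : U 1%N S :&: nbr_in c (U 0%N S) = set0.
      apply/setP => x; rewrite !inE.
      by case: (x \in D) => //=; case: (codeg S x) => [|[]].
    rewrite cards0 addn0.
    apply: leq_trans (leq_card_setU _ _); apply: subset_leq_card.
    apply/subsetP => x; rewrite !inE (codegU1 x cS).
    by case: (x \in D) => //=; case: (codeg S x) => [|[]] //=; case: (adj c x).
  by rewrite -(ler_nat R) !natrD; lra.
(* Sum the bound [U0c] over [T]: an uncovered vertex of [D] has at least one neighbour in [T], a
   vertex covered once has at most [m]. *)
have U0le : (#|U 0%N S|)%:R <= l * (#|T|)%:R + m * (#|U 1%N S|)%:R.
  apply: (@le_trans _ _ (\sum_(c in T) (#|nbr_in c (U 0%N S)|)%:R)).
    rewrite sum_codeg -sum1_card natr_sum; apply: ler_sum => x.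
    by rewrite inE ler_nat => /andP[/codD[]].
  apply: (le_trans (ler_sum _ U0c)).
  rewrite big_split /= sumr_const mulr_natr lerD2l sum_codeg mulr_natr.
  rewrite -sumr_const; apply: ler_sum => x.
  by rewrite inE => /andP[/codD[]].
have coverS : (#|D :\: U 0%N S|)%:R <= Del * (#|S|)%:R.
  apply: (@le_trans _ _ (\sum_(c in S) (#|nbr_in c D|)%:R)); last first.
    rewrite mulr_natr -sumr_const; apply: ler_sum => c cS.
    by apply: degD; apply: (subsetP ST).
  rewrite sum_codeg -sum1_card natr_sum.
  rewrite [leRHS](big_setID (D :\: U 0%N S)) /= (setIidPr (subsetDl _ _)).
  rewrite -[leLHS]addr0 lerD ?sumr_ge0 //; apply: ler_sum => x.
  by rewrite !inE ler_nat lt0n => /andP[+ xD]; rewrite xD.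
have U1le : (#|U 1%N S|)%:R <= Del * (#|S|)%:R.
  apply: le_trans coverS; rewrite ler_nat subset_leq_card //.
  by apply/subsetP => x; rewrite !inE => /andP[-> /eqP->].
have -> : (#|D|)%:R = (#|U 0%N S|)%:R + (#|D :\: U 0%N S|)%:R :> R.
  rewrite -natrD -(cardsID (U 0%N S) D); congr (_ + _)%:R.
  by apply: eq_card => x; rewrite !inE; case: (x \in D).
have := ler_wpM2l m0 U1le; lra.
Qed.

(* [T] maximizes the size of its neighbourhood in [B], minus [l * #|T|]. *)
Lemma covering_set C B (l : R) : 0 <= l ->
  exists2 T : {set G}, T \subset C &
    l * (#|T|)%:R <= (#|[set x in B | (0 < codeg T x)%N]|)%:R /\
    forall c, c \in C -> (#|nbr_in c [set x in B | codeg T x == 0%N]|)%:R <= l.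
Proof.
move=> l0; pose U T := [set x in B | (0 < codeg T x)%N].
have [T TC Tmax] := @ex_max_set (fun T => T \subset C)
   (fun T => (#|U T|)%:R - l * (#|T|)%:R) set0 (sub0set C).
exists T => //; split.
  by have := Tmax _ (sub0set C); rewrite cards0 mulr0 subr0 -/(U T);
     have := ler0n R #|U set0|; lra.
move=> c cC; case: (boolP (c \in T)) => cT.
  rewrite (_ : nbr_in c _ = set0) ?cards0 //.
  apply/setP => x; rewrite !inE.
  by rewrite (codegD1 x cT); case: (adj c x); rewrite ?andbF.
have := Tmax (c |: T); rewrite subUset sub1set cC TC => /(_ isT).
rewrite cardsU1 cT natrD mulrDr mulr1.
set N := nbr_in c _.
have : (#|U T| + #|N| <= #|U (c |: T)|)%N.
  rewrite -cardsUI.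
  have -> : U T :&: N = set0.
    apply/setP => x; rewrite !inE.
    by case: (x \in B) => //=; case: (codeg T x).
  rewrite cards0 addn0; apply: subset_leq_card.
  apply/subsetP => x; rewrite !inE (codegU1 x cT).
  by case: (x \in B) => //=; case: (codeg T x) => [|k]; case: (adj c x).
by rewrite -(ler_nat R) natrD; lra.
Qed.

(* Induction on the scale [Del]: a set [T] covers a part of [B] with codegrees
   bounded on average, where [private_neighbours] applies, and all degrees to
   the rest of [B] are at most [Del / 4]. *)
Lemma comb_or_small Gam Del C B : [disjoint C & B] -> 0 <= Gam -> 0 <= Del ->
  (forall x, x \in B -> exists2 c, c \in C & adj c x) ->
  (forall c, c \in C -> (#|nbr_in c B|)%:R <= Del) ->
  (forall s (a : 'I_s -> G) (B' : 'I_s -> {set G}), (0 < s)%N ->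
     (forall i, a i \in C) -> (forall i, B' i \subset B) ->
     ~ comb (Gam / s%:R ^+ 2) a B') ->
  (#|B|)%:R ^+ 2 <= 272 ^+ 2 * (Gam * Del).
Proof.
move=> disCB Gam0.
have [k] : exists k, Del < 4 ^+ k.
  exists (Num.bound Del); apply: (lt_le_trans (upper_nthrootP (leqnn _))).
  by apply: lerXn2r; rewrite ?nnegrE; lra.
elim: k Del B disCB => [|k IHk] Del B disCB ltD D0 covB degB nocomb.
  (* Here [Del < 1], so no vertex of [C] has a neighbour in [B]. *)
  suff -> : B = set0 by rewrite cards0 expr2 mul0r mulr_ge0 ?mulr_ge0.
  apply/eqP/set0Pn => -[x xB]; have [c cC cx] := covB x xB.
  suff : (1 : R) <= (#|nbr_in c B|)%:R by have := degB c cC; lra.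
  by rewrite ler1n card_gt0; apply/set0Pn; exists x; rewrite inE xB.
have D4 : 0 <= Del / 4 by lra.
have [T TC [Tle B1deg]] := covering_set C B D4.
set D0' := [set x in B | (0 < codeg T x)%N] in Tle.
set B1 := [set x in B | codeg T x == 0%N] in B1deg.
have D0'B : D0' \subset B by apply/subsetP => x; rewrite inE => /andP[].
have B1B : B1 \subset B by apply/subsetP => x; rewrite inE => /andP[].
have cardB : (#|B|)%:R = (#|D0'|)%:R + (#|B1|)%:R :> R.
  rewrite -natrD -(cardsID D0' B); congr (_ + _)%:R.
    by congr #|pred_of_set _|; apply/setIidPr.
  by apply: eq_card => x; rewrite !inE; case: (x \in B) => //=; case: (codeg T x).
have sqB1 : (#|B1|)%:R ^+ 2 <= 272 ^+ 2 * (Gam * (Del / 4)).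
  apply: IHk => //; first by apply: disjointWr disCB.
  - by move: ltD; rewrite exprS; lra.
  - by move=> x /(subsetP B1B)/covB.
  - move=> s a B' s0 aC B'B; apply: nocomb => // i.
    exact: subset_trans (B'B i) B1B.
(* As 272 = 2 * 136, both parts of [B] have squared size at most [136 ^+ 2 * (Gam * Del)], and (x +
   y)^2 <= 2 x^2 + 2 y^2. *)
suff sqD0 : (#|D0'|)%:R ^+ 2 <= 136 ^+ 2 * (Gam * Del).
  rewrite cardB; set x := (#|D0'|)%:R in sqD0 *; set y := (#|B1|)%:R in sqB1 *.
  have := sqr_ge0 (x - y); rewrite !expr2 in sqD0 sqB1 *; nra.
have degD0 c : c \in T -> (#|nbr_in c D0'|)%:R <= Del.
  move=> cT; apply: le_trans (degB c (subsetP TC c cT)).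
  by rewrite ler_nat subset_leq_card //; apply/subsetP => x;
    rewrite !inE => /andP[/andP[-> _]].
(* By [Tle] the codegrees sum to at most [Del * #|T|], hence to at most four times [#|D0'|]; so at
   most a quarter of [D0'] has codegree above 16. *)
pose D := [set x in D0' | (codeg T x <= 16)%N].
have DD0 : D \subset D0' by apply/subsetP => x; rewrite inE => /andP[].
have cardD : 3 * (#|D0'|)%:R <= 4 * (#|D|)%:R :> R.
  have : 16 * (#|D0' :\: D|)%:R <= Del * (#|T|)%:R.
    apply: (@le_trans _ _ (\sum_(c in T) (#|nbr_in c D0'|)%:R)); last first.
      by rewrite mulr_natr -sumr_const; apply: ler_sum.
    rewrite sum_codeg mulr_natr -sumr_const.
    rewrite [leRHS](big_setID (D0' :\: D)) /= (setIidPr (subsetDl _ _)).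
    rewrite -[leLHS]addr0 lerD ?sumr_ge0 //; apply: ler_sum => x.
    rewrite !inE => /andP[+ /andP[xB xT]]; rewrite xB xT /= -ltnNge => /ltnW.
    by rewrite ler_nat.
  have -> : (#|D0'|)%:R = (#|D|)%:R + (#|D0' :\: D|)%:R :> R.
    rewrite -natrD -(cardsID D D0'); congr ((_ + _)%N)%:R.
    by congr #|pred_of_set _|; apply/setIidPr.
  move: Tle; have -> : (#|D0'|)%:R = (#|D|)%:R + (#|D0' :\: D|)%:R :> R.
    rewrite -natrD -(cardsID D D0'); congr ((_ + _)%N)%:R.
    by congr #|pred_of_set _|; apply/setIidPr.
  lra.
have [||||S ST [privS leD]] := @private_neighbours T D (Del / 16) 16 Del.
- move=> c cT; apply: le_trans (degD0 c cT).
  by rewrite ler_nat subset_leq_card //; apply/subsetP => x;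
    rewrite !inE => /andP[/andP[-> _]].
- by move=> x; rewrite !inE => /andP[/andP[_ ->]]; rewrite ler_nat.
- lra.
- lra.
(* The term [Del / 16 * #|T|] is at most a quarter of [#|D0'|], while [#|D|] is at least three
   quarters; the remaining half is at most [17 * Del * #|S|]. *)
have le34 : (#|D0'|)%:R <= 34 * (Del * (#|S|)%:R) by lra.
have [S0|S_gt0] := posnP #|S|.
  move: le34; rewrite S0 !mulr0 => le0.
  have -> : (#|D0'|)%:R = 0 :> R by apply/le_anti; rewrite le0 ler0n.
  by rewrite expr0n /= mulr_ge0 ?mulr_ge0 ?exprn_ge0.
(* If the private neighbourhoods are large enough they form a forbidden comb. Otherwise
   [Del * #|S| ^+ 2 < 16 * Gam], and 34^2 * 16 = 136^2. *)
have [wide|thin] := lerP (Gam / (#|S|)%:R ^+ 2) (Del / 16).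
  case: (@nocomb _ (fun i : 'I_#|S| => enum_val i)
    (fun i => [set x in D | adj (enum_val i) x & codeg S x == 1%N])) => //.
  - by move=> i; apply: (subsetP TC); apply: (subsetP ST); apply: enum_valP.
  - move=> i; apply: subset_trans D0'B; apply: subset_trans DD0.
    by apply/subsetP => x; rewrite inE => /andP[].
  have priv_eq i x c : x \in [set x in D | adj (enum_val i) x & codeg S x == 1%N] ->
      c \in S -> adj c x -> c = enum_val (A := S) i.
    rewrite inE => /and3P[_ ix /eqP x1] cS cx.
    exact: (codeg1_uniq (enum_valP i) cS x1 ix cx).
  split.
  - exact: enum_val_inj.
  - split=> [i j ij|i j].
      rewrite -setI_eq0; apply/eqP/setP => x; rewrite in_setI in_set0.
      apply/negP => /andP[xi xj]; move: (xj); rewrite inE => /and3P[_ jx _].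
      have := priv_eq i x _ xi (enum_valP j) jx.
      by move/enum_val_inj => E; rewrite E eqxx in ij.
    apply/negP; rewrite inE => /andP[/(subsetP DD0)/(subsetP D0'B) iB _].
    have iC := subsetP TC _ (subsetP ST _ (enum_valP i)).
    by move/pred0P/(_ (enum_val i)): disCB; rewrite /= iC iB.
  - by move=> i x; rewrite inE => /and3P[].
  - move=> i j x ij xj; apply/negP => ix.
    have := priv_eq j x _ xj (enum_valP i) ix.
    by move/enum_val_inj => E; rewrite E eqxx in ij.
  - by move=> i; apply: le_trans wide _; apply: privS; apply: enum_valP.
have s2 : 0 < (#|S|)%:R ^+ 2 :> R by rewrite exprn_gt0 ?ltr0n.
move: thin; rewrite ltr_pdivlMr // => thin.
apply: (@le_trans _ _ ((34 * (Del * (#|S|)%:R)) ^+ 2)).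
  by rewrite ler_sqr ?nnegrE ?mulr_ge0.
have := ler_wpM2l D0 (ltW thin); rewrite !expr2; nra.
Qed.

End Combs.

(** * Equicardinal combs and the bound given by [W] *)

Lemma nat_ceil (R : realType) (x : R) :
  exists2 m : nat, x <= m%:R & forall k : nat, x <= k%:R -> (m <= k)%N.
Proof.
have ex : exists m : nat, x <= m%:R.
  by exists (Num.bound `|x|); rewrite ltW // (le_lt_trans (ler_norm x)) // archi_boundP.
by case: (ex_minnP ex) => m xm minm; exists m.
Qed.

Section Widths.
Variables (R : realType) (G : sgraph).

Lemma width_le t (B : 'I_t -> {set G}) i : (width B <= #|B i|)%N.
Proof.
rewrite /width; elim: (index_enum _) (mem_index_enum i) => // j r IH.
rewrite big_cons inE => /predU1P[->|/IH ir]; first exact: geq_minl.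
by rewrite (leq_trans (geq_minr _ _)).
Qed.

Lemma width_ge t (B : 'I_t -> {set G}) m :
  (m <= #|G|)%N -> (forall i, (m <= #|B i|)%N) -> (m <= width B)%N.
Proof.
move=> mG mB; rewrite /width; apply: (big_ind (fun k => m <= k)%N) => //.
by move=> x y mx my; rewrite leq_min mx.
Qed.

Lemma equicardinal_width t (B : 'I_t -> {set G}) i :
  equicardinal_blockade B -> #|B i| = width B.
Proof.
case=> _ eqB; apply/eqP; rewrite eqn_leq width_le andbT.
by apply: width_ge => [|j]; [exact: max_card | rewrite (eqB i j)].
Qed.

(** Membership in [in_F] requires blocks of equal size. Shrinking the blocks preserves a comb, so
    each is cut down to the least integer size that is at least [w]. *)
Lemma trim_comb t (w : R) (a : 'I_t -> G) (B : 'I_t -> {set G}) :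
  (0 < t)%N -> 0 < w -> comb w a B ->
  exists B' : 'I_t -> {set G},
    [/\ forall i, B' i \subset B i, comb w a B', equicardinal_blockade B',
        w <= (width B')%:R & forall i, (width B' <= #|B i|)%N].
Proof.
move=> t0 w0 [inja [disB aB] adjB nadjB wB].
have [m wm minm] := nat_ceil w.
have sub i : exists X : {set G}, X \subset B i /\ #|X| = m.
  have : (m <= #|B i|)%N by exact: minm.
  move=> le; exists [set x in take m (enum (B i))]; split.
    by apply/subsetP => x; rewrite inE => /mem_take; rewrite mem_enum.
  rewrite cardsE (card_uniqP _) ?take_uniq ?enum_uniq //.
  by rewrite size_take -cardE; case: ltngtP le.
have [B' B'P] := choice sub.
have B'B i : B' i \subset B i by case: (B'P i).
have cardB' i : #|B' i| = m by case: (B'P i).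
have m0 : (0 < m)%N by rewrite -(ltr0n R); apply: lt_le_trans wm.
have combB' : comb w a B'.
  split=> //.
  - split=> [i j ij|i j].
      by apply: disjointW (B'B i) (B'B j) (disB i j ij).
    by apply: contra (aB i j); apply: (subsetP (B'B j)).
  - by move=> i x /(subsetP (B'B i))/adjB.
  - by move=> i j x ij /(subsetP (B'B j)); apply: nadjB.
  - by move=> i; rewrite cardB'.
have eqB' : equicardinal_blockade B'.
  split; last by move=> i j; rewrite !cardB'.
  split; first by case: combB' => _ [].
  by move=> i; rewrite -card_gt0 cardB'.
have wB' : width B' = m.
  by rewrite -(cardB' (Ordinal t0)) (equicardinal_width _ eqB').
exists B'; split=> //; first by rewrite wB'.
by move=> i; rewrite wB' -(cardB' i) subset_leq_card.
Qed.

Lemma W_le s (b : 'I_s -> G) (B : 'I_s -> {set G}) :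
  in_F R b B -> (W R G <= width B)%N.
Proof.
move=> FB; have FwB : F_width R G (width B).
  by apply/asboolP; exists s, b, B; split; first left.
rewrite /W; case: pselect => [ex|[]]; first last.
  by exists (width B).
by case: ex_minnP => m _; exact.
Qed.

(** A comb of width |G| / s^2 in [(C, B)] would, once trimmed, be a member of [in_F] of width at
    most [Del], against the minimality of [W]. So [comb_or_small] applies with [Gam] equal to
    |G|. *)
Lemma sparse_cover_small (a : G) (C B : {set G}) (Del : R) :
  C \subset nbr a -> B \subset non_nbr a -> 0 <= Del -> Del < (W R G)%:R ->
  (forall x, x \in B -> exists2 c, c \in C & adj c x) ->
  (forall c, c \in C -> (#|nbr_in c B|)%:R <= Del) ->
  (#|B|)%:R ^+ 2 <= 272 ^+ 2 * ((#|G|)%:R * Del).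
Proof.
move=> Ca Ba Del0 DelW covB degB.
have disa : [disjoint nbr a & non_nbr a].
  by rewrite -setI_eq0; apply/eqP/setP => x; rewrite !inE andbN.
apply: comb_or_small (covB) (degB) _ => //; first exact: disjointW Ca Ba disa.
move=> s b B' s0 bC B'B combB.
have G0 : 0 < #|G|%:R :> R by rewrite ltr0n; apply/card_gt0P; exists a.
have w0 : 0 < #|G|%:R / s%:R ^+ 2 :> R by rewrite divr_gt0 // exprn_gt0 // ltr0n.
have [B2 [B2B combB2 eqB2 _ widthB2]] := trim_comb s0 w0 combB.
have : in_F R b B2.
  split=> //; exists a; split=> // i; first exact: (subsetP Ca).
  exact: subset_trans (B2B i) (subset_trans (B'B i) Ba).
move/W_le; apply/negP; rewrite -ltnNge -(ltr_nat R); apply: le_lt_trans DelW.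
apply: le_trans (degB _ (bC (Ordinal s0))); rewrite ler_nat.
apply: (leq_trans (widthB2 (Ordinal s0))); apply: subset_leq_card.
apply/subsetP => x xB; rewrite inE (subsetP (B'B _) x xB) /=.
by case: combB => _ _ adjB _ _; apply: adjB xB.
Qed.

End Widths.

(** * Unions of anticomplete cographs, and independent sets in digraphs *)

Section Cographs.
Variable G : sgraph.
Implicit Types X Y Z : {set G}.

Definition anticomplete X Y := forall x y, x \in X -> y \in Y -> ~~ adj x y.

Lemma cographU X Y : [disjoint X & Y] -> anticomplete X Y ->
  cograph (induced X) -> cograph (induced Y) -> cograph (induced (X :|: Y)).
Proof.
move=> disXY anti cX cY; apply: cograph_iso (cograph_union cX cY).
pose f (u : disjoint_union (induced X) (induced Y)) : induced (X :|: Y) :=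
  match u with
  | inl x => exist _ (val x) (subsetP (subsetUl X Y) _ (valP x))
  | inr y => exist _ (val y) (subsetP (subsetUr X Y) _ (valP y))
  end.
have disF x : x \in X -> x \in Y -> False.
  by move=> xX xY; move/pred0P/(_ x): disXY; rewrite /= xX xY.
exists f.
  apply: inj_card_bij.
    move=> [x|x] [y|y] /(congr1 val) /= E.
    - by congr inl; apply: val_inj.
    - by case: (disF (sval x)); [exact: (valP x) | rewrite E; exact: (valP y)].
    - by case: (disF (sval y)); [exact: (valP y) | rewrite -E; exact: (valP x)].
    - by congr inr; apply: val_inj.
  by rewrite card_sum !card_sig cardsU (disjoint_setI0 disXY) cards0 subn0.
move=> [x|x] [y|y] //=; rewrite /induced_adj /=.
  by apply/negbTE/anti; exact: valP.
by rewrite adj_sym; apply/negbTE/anti; exact: valP.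
Qed.

Definition closed_nbhd Y X : {set G} :=
  [set x in X | (x \in Y) || [exists y in Y, adj y x]].

(** After [closed_nbhd Y U] is deleted, everything left is anticomplete to [Z]. The cographs found
    successively can thus be united, and each pays at rate [rho] for the vertices deleted with
    it. *)
Lemma cograph_local (R : realType) (rho : R) (U : {set G}) :
  (forall X, X \subset U -> X != set0 -> exists Y Z : {set G},
     [/\ Y \subset X, Y != set0, Z \subset Y, cograph (induced Z) &
         rho * (#|closed_nbhd Y X|)%:R <= (#|Z|)%:R]) ->
  U != set0 ->
  exists Z : {set G}, [/\ Z \subset U, cograph (induced Z) &
    rho * (#|U|)%:R <= (#|Z|)%:R].
Proof.
move=> local; have [m] := ubnP #|U|.
elim: m U local => // m IH U local ltm U0.
have [Y [Z [YU Y0 ZY cZ leZ]]] := local U (subxx U) U0.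
have [E|U'0] := eqVneq (U :\: closed_nbhd Y U) set0.
  exists Z; split=> //; first exact: subset_trans ZY YU.
  rewrite (_ : U = closed_nbhd Y U) //; apply/eqP; rewrite eqEsubset.
  by rewrite -setD_eq0 E eqxx; apply/subsetP => x; rewrite inE => /andP[].
have [||| Z' [Z'U cZ' leZ']] := IH (U :\: closed_nbhd Y U).
- by move=> X XU'; apply: local; apply: subset_trans XU' (subsetDl _ _).
- rewrite -ltnS; apply: leq_trans ltm; rewrite !ltnS; apply: proper_card.
  rewrite properE subsetDl; apply/subsetPn.
  have /set0Pn[y yY] := Y0; exists y; first exact: (subsetP YU).
  by rewrite !inE yY (subsetP YU).
- by [].
have Z'N z y : z \in Z' -> y \in Z -> (z != y) && ~~ adj y z.
  move=> zZ' /(subsetP ZY) yY; have /(subsetP Z'U) := zZ'.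
  rewrite !inE => /andP[+ zU]; rewrite zU /= negb_or => /andP[zY].
  move=> /existsPn/(_ y); rewrite yY /= => ->; rewrite andbT.
  by apply: contra zY => /eqP->.
exists (Z :|: Z'); split.
- by rewrite subUset (subset_trans ZY YU) (subset_trans Z'U (subsetDl _ _)).
- apply: cographU => //.
    rewrite -setI_eq0; apply/eqP/setP => x; rewrite !inE; apply/negP => /andP[xZ xZ'].
    by have /andP[/eqP] := Z'N x x xZ' xZ.
  by move=> x y xZ yZ'; have /andP[] := Z'N y x yZ' xZ.
- have -> : #|U| = (#|closed_nbhd Y U| + #|U :\: closed_nbhd Y U|)%N.
    rewrite -(cardsID (closed_nbhd Y U) U); congr addn.
    by congr #|pred_of_set _|; apply/setIidPr/subsetP => x; rewrite inE => /andP[].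
  rewrite cardsU (_ : Z :&: Z' = set0) ?cards0 ?subn0 ?natrD ?mulrDr ?lerD //.
  apply/setP => x; rewrite !inE; apply/negP => /andP[xZ xZ'].
  by have /andP[/eqP] := Z'N x x xZ' xZ.
Qed.

End Cographs.

(* A digraph with in-degrees at most [kap] has average total degree at most
   [2 * kap], so independent vertices can be picked greedily. *)
Lemma digraph_independent (T : finType) (r : rel T) (kap m : nat) (D : {set T}) :
  (forall y, y \in D -> (#|[set x in D | r x y]| <= kap)%N) ->
  (m * (2 * kap + 1) <= #|D|)%N ->
  exists2 S : {set T}, S \subset D & #|S| = m /\
    forall x y, x \in S -> y \in S -> x != y -> ~~ r x y.
Proof.
elim: m D => [|m IH] D indeg le.
  by exists set0; [exact: sub0set | rewrite cards0; split=> // x y; rewrite inE].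
(* Out-degrees and in-degrees have the same sum, so some out-degree is at most [kap]. Choosing this
   vertex discards at most [2 * kap + 1] vertices, itself included. *)
have [x xD outx] : exists2 x, x \in D & (#|[set y in D | r x y]| <= kap)%N.
  apply/exists_inP; apply: contraT => /exists_inPn out.
  have : (\sum_(x in D) #|[set y in D | r x y]| <= \sum_(y in D) kap)%N.
    have E (P : pred T) : #|[set y in D | P y]| = (\sum_(y in D) P y)%N.
      rewrite -sum1_card (eq_bigl (fun y => (y \in D) && P y)); last first.
        by move=> y; rewrite inE.
      by rewrite big_mkcondr /=; apply: eq_bigr => y _; case: (P y).
    under eq_bigr do rewrite E.
    rewrite exchange_big /=; apply: leq_sum => y yD.
    by rewrite -E indeg.
  rewrite leqNgt; apply: contraNT => _; rewrite sum_nat_const.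
  have : (\sum_(x in D) kap.+1 <= \sum_(x in D) #|[set y in D | r x y]|)%N.
    by apply: leq_sum => x xD; rewrite ltnNge out.
  rewrite sum_nat_const; apply: leq_trans; rewrite ltn_mul2l leqnn andbT.
  by apply: leq_trans le; rewrite mulSn addn1 addnC ltn_addl // ltn_addl.
pose D' := D :\: (x |: ([set y in D | r x y] :|: [set y in D | r y x])).
have [||S SD [cardS indS]] := IH D'.
- move=> y; rewrite inE => /andP[_ yD]; apply: leq_trans (indeg y yD).
  apply: subset_leq_card; apply/subsetP => z; rewrite !inE.
  by case/andP => /andP[_ ->].
- rewrite cardsD; set N := (x in #|_ :&: x|).
  have : (#|D :&: N| <= 2 * kap + 1)%N.
    apply: leq_trans (subset_leq_card (subsetIr _ _)) _.
    rewrite cardsU1 addnC leq_add ?leq_b1 // mul2n -addnn.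
    by apply: (leq_trans (leq_card_setU _ _)); rewrite leq_add // indeg.
  by move=> leN; rewrite mulSn in le; apply: leq_trans (leq_sub2l _ leN);
    rewrite leq_subRL ?(leq_trans _ le) ?leq_addr.
exists (x |: S).
  rewrite subUset sub1set xD; apply: subset_trans SD _; exact: subsetDl.
have SN y : y \in S -> [/\ y != x, ~~ r x y & ~~ r y x].
  move/(subsetP SD); rewrite !inE !negb_or => /andP[/and3P[yx + +] yD].
  by rewrite yD.
have xS : x \notin S by apply/negP => /SN[/eqP].
split; first by rewrite cardsU1 cardS xS.
move=> y z; rewrite !inE => /predU1P[->|yS] /predU1P[->|zS].
- by rewrite eqxx.
- by have [] := SN z zS.
- by have [] := SN y yS.
- exact: indS.
Qed.

(** * Estimates on real powers *)

Section Estimates.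
Variable R : realType.
Implicit Types (d tau t n u x y z v : R).

Lemma powR_root8 t : 0 <= t -> (t `^ (1 / 8)) ^+ 8 = t.
Proof.
by move=> t0; rewrite -powR_mulrn ?powR_ge0 // -powRrM mulfVK ?powRr1 ?pnatr_eq0.
Qed.

Lemma powR_pred d t : 0 < t -> t `^ d = t * t `^ (d - 1).
Proof.
move=> t0; rewrite -[t in t * _]powRr1 ?ltW // -powRD ?(gt_eqF t0) ?implybT //.
by congr (_ `^ _); lra.
Qed.

Lemma powR_double d t : t `^ (2 * d) = (t `^ d) ^+ 2.
Proof. by rewrite mulrC powRrM powR_mulrn ?powR_ge0. Qed.

Lemma le_powR d x y : 0 <= d -> 0 <= x -> x <= y -> x `^ d <= y `^ d.
Proof.
by move=> d0 x0 xy; apply: ge0_ler_powR; rewrite // nnegrE // (le_trans x0).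
Qed.

Lemma root8_ge6 t : 10 ^+ 7 <= t -> 6 <= t `^ (1 / 8).
Proof.
move=> t7; have t0 : 0 <= t by lra.
rewrite leNgt; apply/negP => lt6.
(* 6^8 = 1679616 is below 10^7. *)
have : (t `^ (1 / 8)) ^+ 8 < 6 ^+ 8.
  by rewrite ltr_pXn2r ?nnegrE ?powR_ge0.
by rewrite powR_root8 //; lra.
Qed.

(* With [z = (n / Y) `^ d^-1] and [a = z `^ (1 / 8)], the claim is
   [a * (Y + N) <= u]. The last hypothesis is used when [t ^+ 2 < z], the
   previous one otherwise. *)
Lemma power_estimate d tau t n u Y N :
  2 <= d -> tau < 1 / (8 * d) -> 10 ^+ 7 <= t -> 0 < Y ->
  Y <= n / t `^ d -> u = n / t `^ (d - 1) -> 0 <= N ->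
  N * (t `^ (1 / 8)) ^+ 4 <= u ->
  (Y < n / t `^ (2 * d) -> N ^+ 2 <= 272 ^+ 2 * (n * Y)) ->
  n `^ tau / u * (Y + N) <= Y `^ tau.
Proof.
move=> d2 taud t7 Y0 Yle uE N0 Hshort Hsparse.
have d0 : 0 < d by lra.
have t0 : 0 < t by lra.
have td0 : 0 < t `^ d by rewrite powR_gt0.
have T0 : 0 < t `^ (d - 1) by rewrite powR_gt0.
have n0 : 0 < n.
  by have : 0 < n / t `^ d by [exact: lt_le_trans Yle];
    rewrite pmulr_lgt0 // invr_gt0.
have u0 : 0 < u by rewrite uE divr_gt0.
have q0 : 0 < n / Y by rewrite divr_gt0.
pose z := (n / Y) `^ d^-1.
have z0 : 0 < z by rewrite powR_gt0.
have zd : z `^ d = n / Y.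
  by rewrite -powRrM mulVf ?gt_eqF // powRr1 // ltW.
have tz : t <= z.
  have : t `^ d <= n / Y by move: Yle; rewrite !ler_pdivlMr // mulrC.
  have d'0 : 0 <= d^-1 by rewrite invr_ge0 ltW.
  move=> /(le_powR d'0 (ltW td0)).
  by rewrite -powRrM mulfV ?gt_eqF // powRr1 // ltW.
have v6 := root8_ge6 t7; have v8 := powR_root8 (ltW t0).
have a8 := powR_root8 (ltW z0).
have av : t `^ (1 / 8) <= z `^ (1 / 8) by apply: le_powR => //; lra.
set v := t `^ (1 / 8) in v6 v8 av Hshort; set a := z `^ (1 / 8) in a8 av.
have TZ : t `^ (d - 1) <= z `^ (d - 1) by apply: le_powR => //; lra.
have nE : n = Y * (a ^+ 8 * z `^ (d - 1)).
  by rewrite a8 -powR_pred // zd mulrCA mulfV ?mulr1 // gt_eqF.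
have uT : u * t `^ (d - 1) = n by rewrite uE divfK ?gt_eqF.
have T2Z : t ^+ 2 <= z -> t `^ (d - 1) ^+ 2 <= z `^ (d - 1).
  move=> t2z; rewrite expr2 -powRM ?(ltW t0) // -expr2.
  by apply: le_powR => //; [lra | rewrite exprn_ge0 // ltW].
(* With n = Y * z^d, the excess factor is z^(d * tau), at most z^(1/8) because [d * tau < 1 / 8] and
   z >= 1. *)
have Ytau : n `^ tau <= Y `^ tau * a.
  have -> : n = Y * z `^ d by rewrite zd mulrCA mulfV ?mulr1 // gt_eqF.
  rewrite (powRM _ (ltW Y0) (powR_ge0 z d)) (ler_pM2l (powR_gt0 tau Y0)) -powRrM.
  apply: ler_powR; first by lra.
  by move: taud; rewrite !ltr_pdivlMr ?mulr_gt0 // => H; rewrite ler_pdivlMr //; lra.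
have a0 : 0 < a by rewrite powR_gt0.
have td2 : t `^ (2 * d) = (t * t `^ (d - 1)) ^+ 2.
  by rewrite powR_double (powR_pred d t0).
rewrite {}td2 in Hsparse.
move: (t `^ (d - 1)) (z `^ (d - 1)) T0 TZ nE uT T2Z Hsparse {uE} => T Z T0 TZ nE uT T2Z Hsparse.
have pow_a k : 1 <= a ^+ k by rewrite exprn_ege1 //; lra.
have aY : 2 * (a * Y) <= u.
  rewrite -(ler_pM2r T0) uT nE.
  have : 2 * a <= a ^+ 8.
    rewrite exprS mulrC ler_pM2l //; rewrite exprS.
    by have := pow_a 6%N; nra.
  move=> h; have h2 : 2 * a * T <= a ^+ 8 * Z.
    by apply: ler_pM => //; lra.
  by have := ler_wpM2l (ltW Y0) h2; lra.
(* If a <= v^2, then 2 a <= v^4 and [Hshort] suffices. Otherwise z = a^8 exceeds v^16 = t^2. *)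
have aN : 2 * (a * N) <= u.
  have [av2|va2] := lerP a (v ^+ 2).
    apply: le_trans Hshort; rewrite mulrA mulrC; apply: ler_wpM2l => //.
    have -> : v ^+ 4 = v ^+ 2 * v ^+ 2 by rewrite -exprD.
    have := sqr_ge0 v; rewrite expr2 in av2 *; nra.
  have t2z : t ^+ 2 < z.
    rewrite -v8 -a8 -exprM mulnC exprM; apply: ltrXn2r => //.
      by rewrite exprn_ge0 //; lra.
  have a36 : 36 <= a by move: va2; rewrite expr2; nra.
  have Z0 : 0 < Z by lra.
  (* Here n = Y * z * Z, and (t * T)^2 < z * Z since t^2 < z and T^2 <= Z. *)
  have /Hsparse N2 : Y < n / (t * T) ^+ 2.
    rewrite ltr_pdivlMr ?exprn_gt0 ?mulr_gt0 // nE ltr_pM2l // exprMn a8.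
    apply: (@lt_le_trans _ _ (z * T ^+ 2)); first by rewrite ltr_pM2r ?exprn_gt0.
    by rewrite ler_pM2l //; apply/T2Z/ltW.
  have big : 4 * 272 ^+ 2 * a ^+ 2 <= a ^+ 8.
    rewrite (exprD a 2 6) mulrC; apply: ler_wpM2l; first exact: sqr_ge0.
    apply: (@le_trans _ _ (36 ^+ 6)); first by lra.
    by apply: lerXn2r; rewrite ?nnegrE; lra.
  have T2 := T2Z (ltW t2z).
  have h3 : 4 * 272 ^+ 2 * a ^+ 2 * T ^+ 2 <= a ^+ 8 * Z.
    by apply: ler_pM; rewrite ?mulr_ge0 ?exprn_ge0 ?(ltW a0) ?(ltW T0) //; lra.
  (* Squared and multiplied by T^2, the right-hand side is n^2 = n * Y * a^8 * Z, which [h3]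
     compares with the bound from [N2]. *)
  rewrite -ler_sqr ?nnegrE ?mulr_ge0 ?(ltW a0) ?(ltW u0) //.
  rewrite -(ler_pM2r (exprn_gt0 2 T0)) -[u ^+ 2 * _]exprMn uT.
  have h4 : (2 * (a * N)) ^+ 2 * T ^+ 2 <= 4 * a ^+ 2 * T ^+ 2 * (272 ^+ 2 * (n * Y)).
    rewrite (_ : (2 * (a * N)) ^+ 2 * T ^+ 2 = 4 * a ^+ 2 * T ^+ 2 * N ^+ 2); last by ring.
    by apply: ler_wpM2l => //; rewrite ?mulr_ge0 ?exprn_ge0 ?(ltW a0) ?(ltW T0).
  apply: le_trans h4 _.
  have := ler_wpM2l (mulr_ge0 (ltW n0) (ltW Y0)) h3.
  by rewrite -[X in _ <= X -> _]mulrA -nE expr2; lra.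
rewrite mulrAC ler_pdivrMr //.
apply: le_trans (ler_wpM2r (addr_ge0 (ltW Y0) N0) Ytau) _.
rewrite -mulrA ler_wpM2l ?powR_ge0 // mulrDr; lra.
Qed.

End Estimates.

(** * A vertex with a large second neighbourhood *)

Section SecondNeighbourhoods.
Variables (R : realType) (G : sgraph).
Implicit Types (X U : {set G}) (b : G) (d tau t : R).

(** A vertex [b] of [X] with a neighbour in [X] belongs to its own second neighbourhood, in line
    with [non_nbr b] containing [b]. *)
Definition second_nbhd b X : {set G} :=
  [set x in X | ~~ adj b x & [exists c in nbr_in b X, adj c x]].

(* Otherwise remove, as long as possible, the closed neighbourhood in [X] of [N[b]],
   where [X] is what is left of [U] and [b] has maximum degree in [X]: the sets
   [N[b]] are pairwise anticomplete, and the union of their large cographs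
   contradicts criticality. *)
Lemma large_second_nbhd d tau t U :
  2 <= d -> tau < 1 / (8 * d) -> 10 ^+ 7 <= t -> tau_critical tau G ->
  #|G|%:R / t `^ (2 * d) <= (W R G)%:R -> U != set0 ->
  (#|U|)%:R = #|G|%:R / t `^ (d - 1) ->
  (forall a, a \in U -> (#|nbr_in a U|).+1%:R <= #|G|%:R / t `^ d) ->
  exists2 b, b \in U & (#|U|)%:R < (#|second_nbhd b U|)%:R * (t `^ (1 / 8)) ^+ 4.
Proof.
move=> d2 taud t7 [maxG crit] leW U0 cardU degU.
apply: contrapT => small.
have {}small b : b \in U ->
    (#|second_nbhd b U|)%:R * (t `^ (1 / 8)) ^+ 4 <= (#|U|)%:R :> R.
  by move=> bU; rewrite leNgt; apply/negP => lt; apply: small; exists b.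
have t0 : 0 < t by lra.
have u0 : 0 < (#|U|)%:R :> R by rewrite ltr0n card_gt0.
have n0 : 0 < #|G|%:R :> R.
  by apply: lt_le_trans u0 _; rewrite ler_nat max_card.
(* This rate makes the final cograph have at least |G|^tau vertices. *)
have [|Z [ZU cZ]] := @cograph_local G R (#|G|%:R `^ tau / (#|U|)%:R) U _ U0.
  move=> X XU /set0Pn[b0 b0X].
  have [b bX bmax] : exists2 b, b \in X &
      forall c, c \in X -> (#|nbr_in c X| <= #|nbr_in b X|)%N.
    by case: (arg_maxnP (fun c => #|nbr_in c X|) b0X) => b bX bmax; exists b.
  have bU : b \in U by apply: (subsetP XU).
  pose Y := b |: nbr_in b X.
  have cardY : #|Y| = #|nbr_in b X|.+1 by rewrite cardsU1 inE adj_irrefl andbF.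
  have YX : Y \subset X.
    by rewrite subUset sub1set bX; apply/subsetP => x; rewrite inE => /andP[].
  have bY : b \in Y by rewrite setU11.
  have Y0 : Y != set0 by apply/set0Pn; exists b.
  have degX c : c \in X -> (#|nbr_in c X| <= #|nbr_in c U|)%N.
    move=> cX; apply: subset_leq_card; apply/subsetP => x; rewrite !inE.
    by case/andP => /(subsetP XU)-> ->.
  have leY : (#|Y|)%:R <= #|G|%:R / t `^ d.
    by apply: le_trans (degU b bU); rewrite ler_nat cardY ltnS degX.
  (* Criticality yields cographs only in proper subsets. *)
  have YT : Y != setT.
    apply/eqP => YT; move: leY; rewrite YT cardsT leNgt => /negP[].
    rewrite ltr_pdivrMr ?powR_gt0 // ltr_pMr //.
    have T1 : t `^ 0 <= t `^ (d - 1) by apply: ler_powR; lra.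
    by rewrite powRr0 in T1; rewrite (powR_pred d t0); nra.
  have [Z [ZY cZ leZ]] := crit Y Y0 YT.
  exists Y, Z; split=> //; apply: le_trans leZ.
  apply: (@le_trans _ _ (#|G|%:R `^ tau / (#|U|)%:R *
      ((#|Y|)%:R + (#|second_nbhd b X|)%:R))).
    rewrite ler_wpM2l ?divr_ge0 ?powR_ge0 // -natrD ler_nat.
    apply: leq_trans (leq_card_setU _ _); apply: subset_leq_card.
    apply/subsetP => x; rewrite !inE => /andP[xX]; rewrite xX /=.
    case/orP => [-> //|/exists_inP[y]]; rewrite !inE => /predU1P[->|yb] yx.
      by rewrite yx orbT.
    case: (boolP (adj b x)); rewrite ?orbT //= => _; rewrite orbC.
    by apply/orP; left; apply/exists_inP; exists y; rewrite // inE.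
  apply: (power_estimate d2 taud t7) => //.
  - by rewrite ltr0n card_gt0.
  - apply: le_trans (small b bU); rewrite ler_wpM2r ?exprn_ge0 ?powR_ge0 //.
    rewrite ler_nat subset_leq_card //; apply/subsetP => x; rewrite !inE.
    case/and3P => /(subsetP XU)-> -> /exists_inP[c]; rewrite inE => /andP[cX bc] cx.
    by apply/exists_inP; exists c; rewrite // inE (subsetP XU).
  (* By the choice of [b], all degrees in [X] are below [#|Y|], which serves as the degree bound and
     is here less than [W]. *)
  - move=> ltY; apply: (@sparse_cover_small _ _ b (nbr_in b X)) => //.
    + by apply/subsetP => x; rewrite !inE => /andP[].
    + by apply/subsetP => x; rewrite !inE => /and3P[].
    + exact: lt_le_trans ltY leW.
    + by move=> x; rewrite inE => /and3P[_ _ /exists_inP].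
    + move=> c; rewrite inE => /andP[cX _]; rewrite ler_nat cardY.
      apply: leq_trans (leqW (bmax c cX)); apply: subset_leq_card.
      by apply/subsetP => x; rewrite !inE => /andP[/andP[-> _] ->].
rewrite divfK ?gt_eqF // => leZ.
move: maxG; rewrite ltNge => /negP[]; apply: le_trans leZ _; rewrite ler_nat.
by apply: (@leq_bigmax_cond _ _ (fun X : {set G} => #|X|)); apply/asboolP.
Qed.

End SecondNeighbourhoods.

(** * Pieces inside blocks and the comb selected from them *)

(** A fibre of [f] in [D] counts on the left only if its size is less than [k] times that of its
    trace on [N]; summing over the fibres gives the bound. *)
Lemma heavy_classes (T I : finType) (f : T -> I) (D N : {set T}) (k : nat) :
  (#|[set x in D | #|[set y in D | f y == f x]| <
                   k * #|[set y in D | f y == f x] :&: N|]| <= k * #|D :&: N|)%N.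
Proof.
set X := finset _.
have fibers (Z : {set T}) : #|Z| = (\sum_i #|[set x in Z | f x == i]|)%N.
  rewrite -sum1_card (partition_big f xpredT) //=; apply: eq_bigr => i _.
  by rewrite -sum1_card; apply: eq_bigl => x; rewrite inE.
rewrite (fibers X) (fibers (D :&: N)) big_distrr /=; apply: leq_sum => i _.
have [->|/set0Pn[x]] := eqVneq [set x in X | f x == i] set0; first by rewrite cards0.
rewrite !inE => /andP[/andP[xD /ltnW le] /eqP fx]; rewrite -{}fx.
rewrite [X in (_ <= k * #|pred_of_set X|)%N](_ : _ = [set y in D | f y == f x] :&: N).
  apply: leq_trans le; apply: subset_leq_card; apply/subsetP => y.
  by rewrite !inE => /andP[/andP[-> _] ->].
by apply/setP => y; rewrite !inE andbAC.
Qed.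

Section Pieces.
Variables (R : realType) (G : sgraph).

(* [f x] records a common neighbour [(f x).1] of the piece containing [x] and the
   block [(f x).2] containing this piece. *)
Lemma greedy_pieces t (A : 'I_t -> {set G}) (C B : {set G}) (p : R) :
  (0 < t)%N -> 0 < p ->
  exists (D : {set G}) (f : G -> G * 'I_t),
    [/\ D \subset B,
        forall x, x \in D -> [/\ (f x).1 \in C, adj (f x).1 x, x \in A (f x).2 &
          p <= (#|[set y in D | f y == f x]|)%:R] &
        forall c i, c \in C -> (#|nbr_in c (A i :&: (B :\: D))|)%:R < p].
Proof.
move=> t0 p0; have [m] := ubnP #|B|; elim: m B => // m IH B ltB.
have [[c [i [cC lep]]]|none] := pselect
    (exists c i, c \in C /\ p <= (#|nbr_in c (A i :&: B)|)%:R); last first.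
  exists set0, (fun x => (x, Ordinal t0)); split; rewrite ?sub0set //.
    by move=> x; rewrite inE.
  move=> c i cC; rewrite setD0 ltNge; apply/negP => lep.
  by apply: none; exists c, i.
set P := nbr_in c (A i :&: B) in lep.
have PB : P \subset B by apply/subsetP => x; rewrite !inE => /andP[/andP[]].
have P0 : (0 < #|P|)%N by rewrite -(ltr_nat R); apply: lt_le_trans lep.
have [|D [f [DB fD small]]] := IH (B :\: P).
  rewrite -ltnS; apply: leq_trans ltB; rewrite !ltnS; apply: proper_card.
  rewrite properE subsetDl; apply/subsetPn.
  move: P0 => /card_gt0P[x xP]; exists x; first exact: (subsetP PB).
  by rewrite inE xP.
(* [D] avoids [P], so the earlier labels are kept. *)
exists (D :|: P), (fun x => if x \in P then (c, i) else f x); split.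
- by rewrite subUset PB andbT; apply: subset_trans DB (subsetDl _ _).
- move=> x; rewrite inE => xDP; case: (boolP (x \in P)) => xP.
    split=> //; first by move: xP; rewrite inE => /andP[].
      by move: xP; rewrite !inE => /andP[/andP[]].
    apply: le_trans lep _; rewrite ler_nat subset_leq_card //.
    by apply/subsetP => y yP; rewrite inE in_setU yP orbT eqxx.
  rewrite (negbTE xP) orbF in xDP; have [? ? ? h] := fD x xDP; split=> //.
  apply: le_trans h _; rewrite ler_nat subset_leq_card //.
  apply/subsetP => y; rewrite inE => /andP[yD fy]; rewrite inE in_setU yD /=.
  by have := subsetP DB y yD; rewrite in_setD => /andP[/negbTE->].
- move=> c' j c'C; apply: le_lt_trans (small c' j c'C).
  by rewrite ler_nat subset_leq_card // setDDl setUC.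
Qed.

(* [p / 2]: each of the other [m - 1] teeth removes at most the fraction
   [1 / (2 * m)] of a piece. *)
Lemma comb_of_pieces t (A : 'I_t -> {set G}) (b : G) (U D : {set G})
    (f : G -> G * 'I_t) (p : R) (m w : nat) :
  (0 < m)%N -> 0 < p -> pairwise_disjoint A ->
  (forall i, A i \subset U) -> (forall i, (#|A i| <= w)%N) ->
  (forall c, c \in U -> (#|nbr_in c U| <= w)%N) ->
  D \subset non_nbr b :&: U ->
  (forall x, x \in D -> [/\ (f x).1 \in nbr b :&: U, adj (f x).1 x,
     x \in A (f x).2 & p <= (#|[set y in D | f y == f x]|)%:R]) ->
  (m * (2 * (w + 2 * m * w) + 1) <= #|D|)%N ->
  exists (a' : 'I_m -> G) (A' : 'I_m -> {set G}),
    comb_in (nbr b :&: U) (non_nbr b :&: U) (p / 2) a' A' /\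
    exists2 g : 'I_m -> 'I_t, injective g & forall j, A' j \subset A (g j).
Proof.
move=> m0 p0 disA AU Aw degU Db fD leD.
pose cls x := [set y in D | f y == f x].
(* [bad x y] bars the pieces of [x] and [y] from being chosen together: they share a block, or the
   tooth of [y] sees too much of the piece of [x]. For fixed [y] the first case costs at most [w]
   vertices, the second [2 * m * w]. *)
pose bad x y := ((f x).2 == (f y).2) ||
  (#|cls x| < 2 * m * #|cls x :&: nbr (f y).1|)%N.
have [|S SD [cardS indS]] :=
  @digraph_independent G bad (w + 2 * m * w) m D _ leD.
  move=> y yD; have [+ _ _ _] := fD y yD; rewrite inE => /andP[_ fyU].
  apply: (@leq_trans (#|A (f y).2| +
     #|[set x in D | #|cls x| < 2 * m * #|cls x :&: nbr (f y).1| ]|)%N).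
    apply: leq_trans (leq_card_setU _ _); apply: subset_leq_card.
    apply/subsetP => x; rewrite !inE => /andP[xD /orP[/eqP fxy|lt]].
      by have [_ _ xA _] := fD x xD; rewrite -fxy xA.
    by rewrite xD lt orbT.
  apply: leq_add; first exact: Aw.
  apply: leq_trans (heavy_classes _ _ _ _) _; rewrite leq_mul2l.
  apply/orP; right; apply: leq_trans (degU _ fyU); apply: subset_leq_card.
  apply/subsetP => x; rewrite !inE => /andP[/(subsetP Db)].
  by rewrite inE => /andP[_ ->].
subst m.
have xD j : enum_val (A := S) j \in D by apply: (subsetP SD); apply: enum_valP.
pose x (j : 'I_#|S|) : G := enum_val j.
pose a' j := (f (x j)).1.
pose A' j := cls (x j) :\: \bigcup_(l | l != j) nbr (a' l).
have good j l : j != l -> ~~ bad (x j) (x l).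
  move=> jl; apply: indS; rewrite ?enum_valP //.
  by apply: contra jl => /eqP/enum_val_inj->.
have A'sub j y : y \in A' j -> [/\ y \in D, f y = f (x j) &
    forall l, l != j -> ~~ adj (a' l) y].
  rewrite !inE => /andP[/bigcupP nadj /andP[yD /eqP fy]]; split=> // l lj.
  by apply/negP => aly; apply: nadj; exists l; rewrite // inE.
have A'A j : A' j \subset A (f (x j)).2.
  by apply/subsetP => y /A'sub[yD <- _]; have [] := fD y yD.
have injf : injective (fun j => (f (x j)).2).
  move=> j l E; apply/eqP; apply: contraT => /good.
  by rewrite /bad E eqxx.
have disU : [disjoint nbr b :&: U & non_nbr b :&: U].
  rewrite -setI_eq0; apply/eqP/setP => y; rewrite !inE.
  by case: (adj b y); rewrite ?andbF.
have a'U j : a' j \in nbr b :&: U by have [] := fD _ (xD j).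
have A'U j : A' j \subset non_nbr b :&: U.
  by apply/subsetP => y /A'sub[yD _ _]; apply: (subsetP Db).
have cls_gt0 j : (0 < #|cls (x j)|)%N.
  by have [_ _ _ lep] := fD _ (xD j); rewrite -(ltr_nat R) (lt_le_trans p0 lep).
have few j l : j != l -> (2 * #|S| * #|cls (x j) :&: nbr (a' l)| <= #|cls (x j)|)%N.
  by move=> /good; rewrite /bad negb_or -leqNgt => /andP[].
exists a', A'; split; last by exists (fun j => (f (x j)).2).
split=> //; split.
(* Equal teeth would see each other's whole piece, against [few]. *)
- move=> j l E; apply/eqP; apply: contraT => /few; rewrite -E.
  rewrite (setIidPl _); last first.
    apply/subsetP => y; rewrite !inE => /andP[yD /eqP fy].
    by have [_ + _ _] := fD y yD; rewrite fy.
  rewrite leqNgt => /negP[]; rewrite -[X in (X < _)%N]mul1n ltn_mul2r cls_gt0 /=.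
  exact: (leq_mul (leqnn 2) m0).
- split=> [j l jl|j l].
    apply: disjointW (A'A j) (A'A l) (disA _ _ _).
    by apply: contra jl => /eqP/injf->.
  apply/negP => /(subsetP (A'U l)) h.
  by move/pred0P/(_ (a' j)): disU; rewrite /= a'U h.
- move=> j y /A'sub[yD fy _]; have [_ + _ _] := fD y yD.
  by rewrite fy.
- by move=> l j y lj /A'sub[_ _]; apply.
- move=> j; rewrite ler_pdivrMr // -natrM.
  have [_ _ _ lep] := fD _ (xD j); apply: le_trans lep _; rewrite ler_nat.
  suff : (2 * #|cls (x j) :&: \bigcup_(l | l != j) nbr (a' l)| <= #|cls (x j)|)%N.
    have := cardsID (\bigcup_(l | l != j) nbr (a' l)) (cls (x j)).
    rewrite -/(A' j) => <-.
    by rewrite mul2n muln2 -!addnn leq_add2l leq_add2r.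
  (* Scaled by [#|S|], each other tooth contributes at most [#|cls (x j)|], and there are fewer than
     [#|S|] of them. *)
  rewrite -(leq_pmul2l m0).
  apply: (@leq_trans (\sum_(l | l != j) 2 * #|S| * #|cls (x j) :&: nbr (a' l)|)%N).
    rewrite mulnA (mulnC #|S|) -big_distrr /= leq_mul2l; apply/orP; right.
    rewrite big_distrr /=.
    elim/big_rec2: _ => [|l k V _ le]; first by rewrite cards0.
    by apply: leq_trans (leq_card_setU _ _) _; rewrite leq_add2l.
  apply: (@leq_trans (\sum_(l < #|S|) #|cls (x j)|)%N); last first.
    by rewrite sum_nat_const card_ord.
  rewrite [leqRHS](bigD1 j) //= -[leqLHS]add0n leq_add //.
  by apply: leq_sum => l lj; apply: few; rewrite eq_sym.
Qed.

End Pieces.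

(** * Choice of constants and assembly of the comb *)

Theorem lemma1p1 (R : realType) (k : nat) (d : R) (hk : (2 <= k)%N)
    (hd : 2 <= d) :
  exists (tau0 : R) (L0 : nat), [/\ 0 < tau0, (0 < L0)%N &
    forall (tau : R) (G : sgraph) (t : nat) (A : 'I_t -> {set G}),
      let n : R := #|G|%:R in
      let U : {set G} := \bigcup_(i < t) A i in
      tau < tau0 ->
      strongly_binom2_free k G ->
      tau_critical tau G ->
      equicardinal_blockade A ->
      (width A)%:R = n / t%:R `^ d ->
      n / t%:R `^ (2 * d) <= (W R G)%:R ->
      (L0 <= t)%N ->
      t%:R <= 2 * n `^ (1 / d) ->
      (forall a : G, a \in U -> #|nbr_in a U|%:R < n / t%:R `^ d) ->
      exists (b : G) (t' : nat) (a' : 'I_t' -> G) (A' : 'I_t' -> {set G}),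
        [/\ b \in U,
            comb_in (nbr b :&: U) (non_nbr b :&: U)
              (n / t%:R `^ (2 * d + 2)) a' A',
            equicardinal_blockade A' /\ minor A' A,
            n / t%:R `^ (2 * d + 2) <= (width A')%:R &
            t%:R `^ (1 / 8) <= t'%:R :> R]].
Proof.
have bnd : 10 ^+ 7 < (Num.bound (10 ^+ 7 : R))%:R :> R by apply: archi_boundP; lra.
exists (1 / (8 * d)), (Num.bound (10 ^+ 7 : R)); split.
- by rewrite divr_gt0 // mulr_gt0 //; lra.
- by rewrite -(ltr_nat R); lra.
move=> tau G t A n U ltau _ crit eqA wA leW leL _ degU.
have t7 : 10 ^+ 7 <= t%:R :> R.
  by apply: le_trans (ltW bnd) _; rewrite ler_nat.
have t0 : 0 < t%:R :> R by lra.
have t0N : (0 < t)%N by rewrite -(ltr_nat R).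
have cardA i : #|A i| = width A := equicardinal_width i eqA.
have [[disA A0] _] := eqA.
set w := width A in wA cardA.
have w0 : (0 < w)%N by rewrite -(cardA (Ordinal t0N)) card_gt0.
have AU i : A i \subset U by apply: bigcup_sup.
have U0 : U != set0.
  apply: contraNneq (A0 (Ordinal t0N)) => U0.
  by rewrite -subset0 -U0.
have cardU : #|U| = (t * w)%N.
  rewrite -sum1_card partition_disjoint_bigcup //=.
  under eq_bigr do rewrite sum1_card cardA.
  by rewrite sum_nat_const card_ord.
have td0 : 0 < t%:R `^ d by rewrite powR_gt0.
have td1 : 0 < t%:R `^ (d - 1) by rewrite powR_gt0.
have nE : n = w%:R * t%:R `^ d by rewrite wA divfK ?gt_eqF.
have [||b bU] := large_second_nbhd hd ltau t7 crit leW U0.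
- by rewrite cardU natrM -/n nE (powR_pred d t0) [t%:R * _]mulrC mulrA mulfK ?gt_eqF // mulrC.
(* As n / t^d is the integer [w], a degree strictly below it leaves room for the vertex itself. *)
- by move=> a aU; rewrite -/n -wA ler_nat -(ltr_nat R) wA; apply: degU.
have v6 := root8_ge6 t7; have v8 := powR_root8 (ltW t0).
set v := t%:R `^ (1 / 8) in v6 v8 *.
set B := second_nbhd b U => ltB.
have NbU : nbr_in b U = nbr b :&: U by apply/setP => x; rewrite !inE andbC.
have BU : B \subset non_nbr b :&: U.
  by apply/subsetP => x; rewrite !inE => /and3P[-> ->].
pose q := n / t%:R `^ (2 * d + 2).
have qE : q * t%:R ^+ 2 = n / t%:R `^ (2 * d).
  rewrite /q powRD ?(gt_eqF t0) ?implybT // (powR_mulrn 2 (ltW t0)).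
  by rewrite invfM (mulrA n) divfK // gt_eqF // exprn_gt0.
have n0 : 0 < n by rewrite nE mulr_gt0 // ltr0n.
have q0 : 0 < q by rewrite divr_gt0 ?powR_gt0.
have p0 : 0 < 2 * q by lra.
have [D [f [DB fD small]]] := greedy_pieces A (nbr b :&: U) B t0N p0.
(* Outside [D], a vertex of [C = nbr b :&: U] has fewer than [2 * q] neighbours per block, so at
   most [2 * t * q] in all, which is below [W]. Since n * q * t^2 = w^2, the squared size is at most
   2 * 272^2 * w^2 / t, and t >= 10^7 absorbs the constant. *)
have rest : (#|B :\: D| <= w)%N.
  rewrite -(ler_nat R) -ler_sqr ?nnegrE //.
  apply: (@le_trans _ _ (272 ^+ 2 * (n * (t%:R * (2 * q))))).
    apply: (@sparse_cover_small R G b (nbr b :&: U)).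
    - exact: subsetIl.
    - apply: subset_trans (subsetDl _ _) (subset_trans BU (subsetIl _ _)).
    - by rewrite mulr_ge0 // ltW.
    - apply: lt_le_trans leW; rewrite -/n -qE.
      have -> : t%:R * (2 * q) = q * t%:R * 2 by ring.
      by rewrite expr2 mulrA ltr_pM2l; [lra | rewrite mulr_gt0].
    - move=> x /setDP[]; rewrite inE => /and3P[_ _ /exists_inP[c cb cx]] _.
      by exists c; rewrite // -NbU.
    - move=> c cC; apply: (@le_trans _ _
        (\sum_(i < t) (#|nbr_in c (A i :&: (B :\: D))|)%:R)).
        rewrite -natr_sum ler_nat.
        have -> : nbr_in c (B :\: D) = \bigcup_(i < t) nbr_in c (A i :&: (B :\: D)).
          apply/setP => x; apply/idP/bigcupP.
            rewrite inE => /andP[xBD cx].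
            have : x \in U.
              by case/setDP: xBD => /(subsetP BU); rewrite inE => /andP[].
            by case/bigcupP => i _ xA; exists i; rewrite // inE in_setI xA xBD.
          by case=> i _; rewrite !inE => /andP[/andP[_ ->] ->].
        elim/big_rec2: _ => [|i j V _ le]; first by rewrite cards0.
        by apply: leq_trans (leq_card_setU _ _) _; rewrite leq_add2l.
      apply: (@le_trans _ _ (\sum_(i < t) (2 * q))).
        by apply: ler_sum => i _; apply/ltW/small.
      by rewrite sumr_const card_ord -[leLHS]mulr_natl.
  have wE : n * (t%:R * q) * t%:R = w%:R ^+ 2.
    have -> : n * (t%:R * q) * t%:R = n * (q * t%:R ^+ 2) by ring.
    by rewrite qE powR_double {2}nE; rewrite wA -/n; field; rewrite gt_eqF.
  rewrite -(ler_pM2r t0) -wE.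
  have y0 := ltW (mulr_gt0 (mulr_gt0 n0 (mulr_gt0 t0 q0)) t0).
  by have := ler_wpM2l y0 t7; lra.
have [m vm minm] := nat_ceil v.
have m0 : (0 < m)%N by rewrite -(ltr_nat R); lra.
have mv : m%:R <= 2 * v.
  have : (m.-1)%:R < v.
    by rewrite ltNge; apply/negP => /minm; rewrite -ltnS prednK // ltnn.
  by rewrite -[in X in _ -> X](prednK m0) -natr1; lra.
have wR : 1 <= w%:R :> R by rewrite ler1n.
(* From |U| = v^8 * w one gets |B| >= v^4 * w, so |D| >= (v^4 - 1) * w. The left side is at most 7
   m^2 w <= 28 v^2 w, and v^2 >= 36. *)
have leD : (m * (2 * (w + 2 * m * w) + 1) <= #|D|)%N.
  have : v ^+ 4 * w%:R <= (#|B|)%:R.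
    have v4 : 0 < v ^+ 4 by rewrite exprn_gt0 //; lra.
    rewrite -(ler_pM2r v4); apply: le_trans (ltW ltB).
    by rewrite cardU natrM -v8 (exprD v 4 4) mulrAC.
  have : (#|B| <= #|D| + w)%N.
    rewrite -(cardsID D B) (setIidPr DB) leq_add2l //.
  rewrite -!(ler_nat R) !(natrD, natrM) => le1 le2.
  have m2 : m%:R ^+ 2 <= 4 * v ^+ 2 :> R.
    rewrite (_ : 4 * v ^+ 2 = (2 * v) ^+ 2); last by ring.
    by rewrite ler_sqr ?nnegrE //; lra.
  have m1 : 1 <= m%:R :> R by rewrite ler1n.
  have w1 : w%:R * (v ^+ 4 - 1) <= (#|D|)%:R by lra.
  apply: le_trans w1.
  have v2 : 36 <= v ^+ 2 by rewrite expr2; nra.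
  apply: (@le_trans _ _ (w%:R * (7 * m%:R ^+ 2))).
    have : m%:R <= w%:R * m%:R :> R by apply: ler_peMl.
    have : w%:R * m%:R <= w%:R * m%:R ^+ 2 :> R.
      by rewrite ler_wpM2l // expr2 ler_peMl.
    by rewrite !expr2; lra.
  rewrite ler_wpM2l // (exprD v 2 2); move: m2 v2.
  by move: (m%:R ^+ 2) (v ^+ 2) => x y; nra.
have [|||a' [A' [combA' [g injg A'A]]]] := @comb_of_pieces R G t A b U D f
  (2 * q) m w m0 p0 disA AU _ _ _ fD leD.
- by move=> i; rewrite cardA.
- by move=> c cU; rewrite -(ler_nat R) wA ltW // degU.
- exact: subset_trans DB BU.
have [dis combA'' a'U A'U] := combA'.
rewrite [2 * q]mulrC mulfK ?pnatr_eq0 // in combA''.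
have [A2 [A2A' combA2 eqA2 leA2 _]] := trim_comb m0 q0 combA''.
exists b, m, a', A2; split=> //.
- split=> // j; exact: subset_trans (A2A' j) (A'U j).
- split=> //; exists g => // j; split.
    by case: eqA2 => -[].
  exact: subset_trans (A2A' j) (A'A j).
Qed.
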